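(* Let $G \cong C_{n_1} \times \dots \times C_{n_k}$ be a finite nontrivial abelian group, where $C_{n_i}$, $i=1,\dots,k$, denotes the cyclic group of order $n_i$ and $1 < n_1 \mid n_2 \mid \dots \mid n_k$ (each $n_i$ divides $n_{i+1}$). The following conditions are equivalent. (a) There exists a group $L$ such that $G \cong L/Z(L)$, where $Z(L)$ denotes the center of $L$. (b) $k \geq 2$ and $n_{k-1} = n_k$. (c) There exists a family of subgroups $\{H_i\}_{i \in I}$ of $G$ such that (i) $\bigcap_{i \in I} H_i = 1$, (ii) $\left\langle \bigcup_{i \in I} H_i \right\rangle = G$, (iii) all groups in the family $\{G/H_i\}_{i \in I}$ have the same exponent. (d) There exists a family of subgroups $\{H_i\}_{i \in I}$ of $G$ such that (i) $\bigcap_{i \in I} H_i = 1$, (ii) $\bigcup_{i \in I} H_i = G$, (iii) $G/H_i \cong G/H_j$ for all $i,j \in I$, (iv) $H_i \cong H_j$ for all $i,j \in I$.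
   Context: Groups are written multiplicatively and $1$ also denotes the trivial subgroup. For a subset $S$ of $G$, $\langle S \rangle$ denotes the subgroup generated by $S$. The exponent of a finite group is the least positive integer $e$ such that $g^e = 1$ for every element $g$ of the group. A group satisfying condition (a) is called capable; the group $L$ in (a) is an arbitrary group (not assumed finite). *)

(* Defs.v *)
From HB Require Import structures.
From mathcomp Require Import all_boot all_order all_algebra.
From mathcomp Require Import all_fingroup all_solvable.
From mathcomp Require Import boolp.

Set Implicit Arguments.
Unset Strict Implicit.
Unset Printing Implicit Defensive.

Local Open Scope group_scope.
Local Open Scope quotient_scope.

(* A [groupType] carries a [choiceType] structure; under the axioms of
   mathcomp.classical.boolp every type has one, so [groupType] covers all
   groups, finite or infinite. MathComp's 'Z(_) and quotients only exist for
   subgroups of a [finGroupType], hence the following construction. *)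
Section CentralQuotient.

Variable L : groupType.
Implicit Types x y z : L.

Definition group_center : {pred L} := fun x => `[< forall y, commute x y >].

Definition center_rel x y := x^-1 * y \in group_center.

Lemma group_centerP x :
  reflect (forall y, commute x y) (x \in group_center).
Proof. exact: asboolP. Qed.

Lemma center_relP x y :
  reflect (exists2 z, z \in group_center & y = x * z) (center_rel x y).
Proof.
apply: (iffP idP) => [zxy | [z zZ ->]]; last by rewrite /center_rel mulKg.
by exists (x^-1 * y); rewrite ?mulVKg.
Qed.

Lemma group_center1 : 1 \in group_center.
Proof. by apply/group_centerP => y; rewrite /commute mul1g mulg1. Qed.

Lemma group_centerM x y :
  x \in group_center -> y \in group_center -> x * y \in group_center.
Proof.
move=> /group_centerP cx /group_centerP cy; apply/group_centerP => z.
by rewrite /commute -mulgA (cy z) mulgA (cx z) mulgA.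
Qed.

Lemma group_centerV x : x \in group_center -> x^-1 \in group_center.
Proof.
move=> /group_centerP cx; apply/group_centerP => z.
by apply: (mulgI x); rewrite mulVKg mulgA (cx z) mulgK.
Qed.

Lemma center_rel_refl : reflexive center_rel.
Proof. by move=> x; rewrite /center_rel mulVg group_center1. Qed.

Lemma center_rel_sym : symmetric center_rel.
Proof.
suff imp x y : center_rel x y -> center_rel y x.
  by move=> x y; apply/idP/idP; apply: imp.
by move/group_centerV; rewrite invgM invgK.
Qed.

Lemma center_rel_trans : transitive center_rel.
Proof.
move=> y x z xy yz; rewrite /center_rel.
by rewrite -(mulVKg y z) mulgA group_centerM.
Qed.

Canonical center_equiv :=
  EquivRel center_rel center_rel_refl center_rel_sym center_rel_trans.

Definition central_quotient := {eq_quot center_rel}.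

HB.instance Definition _ := Choice.on central_quotient.
HB.instance Definition _ := EqQuotient.on central_quotient.

Definition cquot_one : central_quotient := lift_cst central_quotient 1.
Definition cquot_inv := lift_op1 central_quotient (fun x => x^-1).
Definition cquot_mul := lift_op2 central_quotient (fun x y => x * y).

Canonical pi_cquot_one := PiConst cquot_one.

Lemma pi_cquot_inv : {morph \pi : x / x^-1 >-> cquot_inv x}.
Proof.
move=> x; unlock cquot_inv; apply/eqP; rewrite eqmodE /=.
have /eqP := reprK (\pi_central_quotient x).
rewrite eqmodE /= center_rel_sym => /center_relP[z zZ ->].
apply/center_relP; exists z^-1; first exact: group_centerV.
have /group_centerP cVz := group_centerV zZ.
by rewrite invgM (cVz x^-1).
Qed.
Canonical pi_cquot_inv_morph := PiMorph1 pi_cquot_inv.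

Lemma pi_cquot_mul : {morph \pi : x y / x * y >-> cquot_mul x y}.
Proof.
move=> x y; unlock cquot_mul; apply/eqP; rewrite eqmodE /=.
have /eqP := reprK (\pi_central_quotient x).
rewrite eqmodE /= center_rel_sym => /center_relP[z zZ ->].
have /eqP := reprK (\pi_central_quotient y).
rewrite eqmodE /= center_rel_sym => /center_relP[t tZ ->].
apply/center_relP; exists (z * t); first exact: group_centerM.
have /group_centerP cz := zZ.
by rewrite -!mulgA; congr (_ * _); rewrite !mulgA (cz y).
Qed.
Canonical pi_cquot_mul_morph := PiMorph2 pi_cquot_mul.

Fact cquot_mulA : associative cquot_mul.
Proof. by elim/quotW=> x; elim/quotW=> y; elim/quotW=> z; rewrite !piE mulgA. Qed.

Fact cquot_mul1g : left_id cquot_one cquot_mul.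
Proof. by elim/quotW=> x; rewrite !piE mul1g. Qed.

Fact cquot_mulg1 : right_id cquot_one cquot_mul.
Proof. by elim/quotW=> x; rewrite !piE mulg1. Qed.

Fact cquot_mulVg : left_inverse cquot_one cquot_inv cquot_mul.
Proof. by elim/quotW=> x; rewrite !piE mulVg. Qed.

Fact cquot_mulgV : right_inverse cquot_one cquot_inv cquot_mul.
Proof. by elim/quotW=> x; rewrite !piE mulgV. Qed.

HB.instance Definition _ := isGroup.Build central_quotient
  cquot_mulA cquot_mul1g cquot_mulg1 cquot_mulVg cquot_mulgV.

End CentralQuotient.

Definition group_isomorphic (A B : groupType) : Prop :=
  exists f : {multiplicative A -> B}, bijective f.

(* 'Z_m is a group under addition, and has m elements as soon as 1 < m. *)
Definition cyclic_product (k : nat) (n : k.-tuple nat) : finGroupType :=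
  {dffun forall i : 'I_k, 'Z_(tnth n i)}.

Section Family.

Variables (gT : finGroupType) (I : Type).
Implicit Type H : I -> {group gT}.

(* Relative to G, so that the empty family has intersection G. *)
Definition family_cap (G : {group gT}) H : {set gT} :=
  [set x in G | `[< forall i, x \in H i >]].

Definition family_cup H : {set gT} := [set x | `[< exists i, x \in H i >]].

End Family.

(* Main.v *)
(* Write G = A \x <[y]> with #[y] = n_k, and let e be n_{k-1} (or 1 if k = 1),
   so that A has exponent dividing e; (b) holds as soon as y ^+ e = 1.
   If G = L / Z(L), then commutators of L are central and make the e-th power of
   a lift of y central, so y ^+ e = 1. Given a family as in (c), all the
   exponents of the G / H_i are #[y]; if #[y] did not divide e, there would be a
   prime p with e dividing q = #[y] / p, and no H_i could contain y ^+ q. But the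
   q-th powers of G lie in <[y ^+ q]>, of order p, so those of H_i are trivial,
   and the H_i would generate a group of exponent dividing q.
   Conversely, let x in A be a basis element of order #[y]. With lambda the
   projection of G to <[y]>, the extension of G by G with cocycle
   (g, h) |-> g ^+ lambda(h) has center its first factor. For (d), take all H
   with H and G / H isomorphic to A and G / A; a change of basis of determinant 1
   in <[x]> \x <[y]> puts any element in such an H, and replacing a basis element
   g_i of A by g_i * y ^+ (n_k / n_i) gives enough H's to separate points. *)

Require Import Defs.
From HB Require Import structures.
From mathcomp Require Import all_boot all_order all_algebra.
From mathcomp Require Import all_fingroup all_solvable.
From mathcomp Require Import boolp.

Set Implicit Arguments.
Unset Strict Implicit.
Unset Printing Implicit Defensive.

Local Open Scope group_scope.

(** * Lifting from a central quotient *)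

Section CentralQuotientTheory.

Local Open Scope quotient_scope.

Variable L : groupType.
Implicit Types x y c : L.

Lemma pi_cquot1 : \pi_(central_quotient L) 1 = 1.
Proof. by rewrite -[RHS]/(cquot_one L) piE. Qed.

Lemma pi_cquotM x y :
  \pi_(central_quotient L) (x * y) =
  \pi_(central_quotient L) x * \pi_(central_quotient L) y.
Proof. exact: pi_cquot_mul. Qed.

Lemma pi_cquot_eqP x y :
  reflect (exists2 c, c \in @group_center L & y = x * c)
    (\pi_(central_quotient L) x == \pi_(central_quotient L) y).
Proof. by rewrite eqmodE; apply: center_relP. Qed.

Lemma pi_cquotX x n :
  \pi_(central_quotient L) (x ^+ n) = \pi_(central_quotient L) x ^+ n.
Proof.
elim: n => [|n IHn]; first by rewrite !expg0 pi_cquot1.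
by rewrite !expgS pi_cquotM IHn.
Qed.

Lemma pi_cquot_eq1 x :
  (\pi_(central_quotient L) x == 1) = (x \in @group_center L).
Proof.
by rewrite -pi_cquot1 eq_sym eqmodE /= /center_rel invg1 mul1g.
Qed.

(** Moving [y] past [x ^+ n], or [y ^+ n] past [x], produces the same central factor [c ^+ n]. If
    [x] commutes with [y ^+ n], this factor is trivial. *)
Lemma central_commutator_commuteX x y c n :
    c \in @group_center L -> y * x = x * y * c ->
  commute x (y ^+ n) -> commute (x ^+ n) y.
Proof.
move=> /group_centerP cC yx.
have xn m : y * x ^+ m = x ^+ m * y * c ^+ m.
  elim: m => [|m IHm]; first by rewrite !expg0 mulg1 mul1g mulg1.
  rewrite !expgSr mulgA IHm -[_ * c ^+ m * x]mulgA -(commuteX _ (esym (cC x))).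
  rewrite (mulgA (_ * y)) -(mulgA _ y x) yx -!mulgA.
  by rewrite (commuteX m (commute_refl c)).
have yn m : y ^+ m * x = x * y ^+ m * c ^+ m.
  elim: m => [|m IHm]; first by rewrite !expg0 !mulg1 mul1g.
  rewrite 2!expgS -mulgA IHm !mulgA yx -!mulgA; do 2!congr (_ * _).
  by rewrite !mulgA (cC (y ^+ m)).
rewrite /commute => /esym; rewrite yn -[RHS]mulg1 => /mulgI cn1.
by rewrite xn cn1 mulg1.
Qed.

(* For lifts Y of y and X of a, [Y, X] is central and X^e is too, hence
   [Y^e, X] = [Y, X]^e = [Y, X^e] = 1, which makes Y^e central. *)
Lemma capable_expg_eq1 (T : groupType)
    (f : {multiplicative T -> central_quotient L}) (y : T) e :
    bijective f -> (forall g h : T, commute g h) ->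
    (forall g, exists a j, a ^+ e = 1 /\ g = a * y ^+ j) ->
  y ^+ e = 1.
Proof.
move=> fbij TC genT; pose r g : L := generic_quotient.repr (f g).
have pir g : \pi_(central_quotient L) (r g) = f g by rewrite reprK.
have f1 : f 1 = 1 by apply: (mulgI (f 1)); rewrite -gmulfM !mulg1.
have fX g n : f (g ^+ n) = f g ^+ n.
  by elim: n => [|n IHn]; rewrite ?expg0 // !expgS gmulfM IHn.
apply: (bij_inj fbij); rewrite f1 fX -pir -pi_cquotX.
apply/eqP; rewrite pi_cquot_eq1; apply/group_centerP => l.
have [f' fK f'K] := fbij.
(* Up to a central factor, [l] is [r a * r y ^+ j], so only commutation of [r y ^+ e] with [r a]
   needs an argument. *)
have [a [j [ae gE]]] := genT (f' (\pi l)).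
have /eqP/pi_cquot_eqP[c /group_centerP cC ->] :
    \pi_(central_quotient L) (r a * r y ^+ j) = \pi_(central_quotient L) l.
  by rewrite pi_cquotM pi_cquotX !pir -fX -gmulfM -gE f'K.
apply: commuteM; last exact/commute_sym/cC.
apply: commuteM; last by apply: commuteX2.
have /eqP/pi_cquot_eqP[d dC dE] :
    \pi_(central_quotient L) (r y * r a) = \pi_(central_quotient L) (r a * r y).
  by rewrite !pi_cquotM !pir -!gmulfM TC.
apply: central_commutator_commuteX dC dE _; apply/commute_sym.
have : r a ^+ e \in @group_center L.
  by rewrite -pi_cquot_eq1 pi_cquotX pir -fX ae f1.
by move/group_centerP.
Qed.

End CentralQuotientTheory.

(** * A central extension with prescribed central quotient *)

Section PowerExtension.

Local Open Scope quotient_scope.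

Variables (T : groupType) (mu : T -> nat).
Hypothesis TC : forall g h : T, commute g h.
Hypothesis muP : forall z g h : T, z ^+ mu (g * h) = z ^+ mu g * z ^+ mu h.
Hypothesis mu_nondegenerate :
  forall g : T, (forall h, g ^+ mu h = h ^+ mu g) -> g = 1.

(* The central extension of T by itself with cocycle (g, h) |-> g ^+ mu h, where
   mu stands for a homomorphism from T to the integers modulo its exponent. *)
Definition power_ext : Type := T * T.
HB.instance Definition _ := Choice.on power_ext.

Definition pext_one : power_ext := (1, 1).
Definition pext_mul (u v : power_ext) : power_ext :=
  (u.1 * v.1 * u.2 ^+ mu v.2, u.2 * v.2).
Definition pext_inv (u : power_ext) : power_ext :=
  (u.1^-1 * u.2 ^+ mu u.2, u.2^-1).

Let mu1 (z : T) : z ^+ mu 1 = 1.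
Proof. by apply: (mulgI (z ^+ mu 1)); rewrite -muP !mulg1. Qed.

(** The cocycle is multiplicative in each argument: [expgMn] handles the base and [muP] the
    exponent. *)
Let pext_mulA : associative pext_mul.
Proof.
move=> [a g] [b h] [c i]; congr (_, _); last exact: mulgA.
rewrite /= muP expgMn; last exact: TC.
rewrite (TC (g ^+ mu i)) !mulgA; congr (_ * _); rewrite -!mulgA.
by do 2!congr (_ * _); rewrite mulgA [RHS]TC.
Qed.

Let pext_mul1g : left_id pext_one pext_mul.
Proof. by case=> a g; rewrite /pext_mul /= expg1n mulg1 !mul1g. Qed.

Let pext_mulg1 : right_id pext_one pext_mul.
Proof. by case=> a g; rewrite /pext_mul /= mu1 !mulg1. Qed.

Let pext_mulVg : left_inverse pext_one pext_inv pext_mul.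
Proof.
case=> a g; rewrite /pext_mul /pext_inv /= mulVg; congr (_, _).
rewrite -mulgA (TC a) mulgA -[a^-1 * _ * _]mulgA -expgMn; last exact: TC.
by rewrite mulgV expg1n mulg1 mulVg.
Qed.

Let pext_mulgV : right_inverse pext_one pext_inv pext_mul.
Proof.
case=> a g; rewrite /pext_mul /pext_inv /= mulgV; congr (_, _).
by rewrite mulVKg -muP mulgV mu1.
Qed.

(** Lifts of [g] and [h] commute exactly when [g ^+ mu h = h ^+ mu g]. Nondegeneracy therefore
    reduces the center to the pairs with second component 1, and the second projection identifies
    the central quotient with [T]. *)
Lemma power_ext_capable :
  exists L : groupType, group_isomorphic T (central_quotient L).
Proof.
pose L : groupType := HB.pack power_ext (isGroup.Build power_ext
  pext_mulA pext_mul1g pext_mulg1 pext_mulVg pext_mulgV).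
have mulLE (u v : L) : u * v = pext_mul u v by [].
have centerE (u : L) : (u \in @group_center L) = (u.2 == 1).
  apply/idP/eqP => [/group_centerP uC | u2].
    apply: mu_nondegenerate => h; have := uC (1, h).
    rewrite /commute !mulLE /pext_mul /= mulg1 mul1g.
    by case=> /mulgI.
  apply/group_centerP => v; rewrite /commute !mulLE /pext_mul u2.
  by rewrite expg1n mu1 !mulg1 mul1g TC.
exists L.
pose f (g : T) : central_quotient L := \pi_(central_quotient L) ((1, g) : L).
have fM : {morph f : g h / g * h}.
  move=> g h; rewrite /f -pi_cquotM; apply/eqP/pi_cquot_eqP.
  exists ((g ^+ mu h, 1) : L); first by rewrite centerE.
  by rewrite !mulLE /pext_mul /= mu1 !mul1g !mulg1.
pose F : {multiplicative T -> central_quotient L} :=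
  HB.pack f (isMultiplicative.Build _ _ f fM).
exists F.
(* The second component does not depend on the representative, since that of a central element is
   1. *)
exists (fun q => (generic_quotient.repr q : power_ext).2) => [g | q] /=.
  set u := generic_quotient.repr _.
  have /eqP/pi_cquot_eqP[c] : \pi_(central_quotient L) ((1, g) : L) =
    \pi_(central_quotient L) u by rewrite reprK.
  by rewrite centerE => /eqP c2 ->; rewrite mulLE /= c2 mulg1.
rewrite -[RHS]reprK; set u := generic_quotient.repr _.
apply/eqP/pi_cquot_eqP; exists ((u.1, 1) : L); first by rewrite centerE.
by rewrite mulLE /pext_mul /= mu1 mul1g !mulg1 -surjective_pairing.
Qed.

End PowerExtension.

(** * Bases and exponents *)

(** The basis is the image of the unit vectors. The bound on the entries matters for the orders:
    ['Z_0] and ['Z_1] have two elements. *)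
Lemma cyclic_product_basis (gT : finGroupType) (G : {group gT}) k
    (n : k.-tuple nat) :
    (forall i, 1 < tnth n i)%N -> G \isog [set: cyclic_product n] ->
  exists g : 'I_k -> gT,
    \big[dprod/1]_i <[g i]> = G /\ forall i, #[g i] = tnth n i.
Proof.
move=> n_gt1; rewrite isog_sym => /isogP[f injf imf].
pose d i : cyclic_product n := dfung1 (Zp1 : 'Z_(tnth n i)).
have dE : \big[dprod/1]_i <[d i]> = [set: cyclic_product n].
  rewrite -[RHS](_ : setXn (fun i => [set: 'Z_(tnth n i)]) = _); last first.
    by apply/setP => x; rewrite !inE; apply/forallP => i; rewrite inE.
  rewrite -(setXn_dprod (fun i => [set: 'Z_(tnth n i)]%G)).
  apply: eq_bigr => i _; rewrite -morphim_dfung1 [X in _ @* X]Zp_cycle.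
  by rewrite morphim_cycle ?inE.
exists (fun i => f (d i)); split=> [|i].
  rewrite -imf -(injm_bigdprod (subxx _) injf dE).
  by apply: eq_bigr => i _; rewrite morphim_cycle ?inE.
rewrite order_injm ?inE // (order_injm (injm_dfung1 _ i)) ?inE //.
by rewrite order_Zp1 Zp_cast.
Qed.

(** The order of [z] divides that of [y], so an exponent known only through the power of [y] it
    gives can still be evaluated on [z]. *)
Lemma eq_expg_dvd (T T' : finGroupType) (y : T) (z : T') i j :
  z ^+ #[y] = 1 -> y ^+ i = y ^+ j -> z ^+ i = z ^+ j.
Proof.
move/eqP; rewrite -order_dvdn => zy /eqP; rewrite eq_expg_mod_order => /eqP ij.
by apply/eqP; rewrite eq_expg_mod_order -(modn_dvdm i zy) ij modn_dvdm.
Qed.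

Lemma val_subgX (gT : finGroupType) (G : {group gT}) (u : subg_of G) m :
  val (u ^+ m) = val u ^+ m.
Proof. by elim: m => [|m IHm] //; rewrite !expgS -IHm. Qed.

Lemma val_subgK (gT : finGroupType) (G : {group gT}) g :
  g \in G -> val (subg G g) = g.
Proof. exact: subgK. Qed.

(** * Groups with a cyclic direct factor *)

Section CyclicDirectFactor.

Variables (gT : finGroupType) (G A : {group gT}) (y : gT).
Hypothesis abelG : abelian G.
Hypothesis defG : A \x <[y]> = G.

Let sAG : A \subset G.
Proof. by have [/normal_sub] := dprod_normal2 defG. Qed.

Let yG : y \in G.
Proof. by have [_ /normal_sub] := dprod_normal2 defG; rewrite cycle_subG. Qed.

Let AyP g : g \in G -> exists a j, [/\ a \in A & g = a * y ^+ j].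
Proof.
case/(mem_dprod defG) => a [b [aA /cycleP[j ->] -> _]]; by exists a, j.
Qed.

Let Ay_inj a b i j :
  a \in A -> b \in A -> a * y ^+ i = b * y ^+ j -> a = b /\ y ^+ i = y ^+ j.
Proof.
move=> aA bA eq_ab; have [_ _ _ /trivgP tiAy] := dprodP defG.
have ab : b^-1 * a \in A :&: <[y]>.
  rewrite inE groupM ?groupV //= (_ : _ * a = y ^+ j * y ^- i).
    by rewrite groupM ?groupV ?mem_cycle.
  by apply: (mulgI b); rewrite mulVKg mulgA -eq_ab mulgK.
have /eqP := set1P (subsetP tiAy _ ab).
rewrite -eq_mulVg1 => /eqP ba; split=> //.
by apply: (mulgI b); rewrite -[RHS]eq_ab ba.
Qed.

Let expA_G : (forall a, a \in A -> a ^+ #[y] = 1) ->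
  forall g, g \in G -> g ^+ #[y] = 1.
Proof.
move=> Ae g /AyP[a [j [aA ->]]]; have aG := subsetP sAG _ aA.
rewrite expgMn; last by apply: (centsP abelG); rewrite ?groupX.
by rewrite -expgM mulnC expgM expg_order expg1n mulg1 Ae.
Qed.

Lemma capable_cyclic_factor (L : groupType) e :
    (forall a, a \in A -> a ^+ e = 1) ->
    group_isomorphic (subg_of G) (central_quotient L) ->
  y ^+ e = 1.
Proof.
move=> Ae [f fbij].
suff: subg G y ^+ e = 1 by move/(congr1 val); rewrite val_subgX val_subgK.
apply: capable_expg_eq1 fbij _ _ => [g h | g].
  by apply: val_inj; apply: (centsP abelG); apply: valP.
have [a [j [aA gE]]] := AyP (valP g).
have aG := subsetP sAG _ aA.
exists (subg G a), j; split; apply: val_inj.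
  by rewrite val_subgX val_subgK ?Ae.
by rewrite [RHS]/(val (subg G a) * val (subg G y ^+ j)) val_subgX !val_subgK.
Qed.

Lemma family_cyclic_factor (I : Type) (H : I -> {group gT}) e :
    (e %| #[y])%N -> (forall a, a \in A -> a ^+ e = 1) ->
    (forall i, H i \subset G) -> family_cap G H = 1 ->
    <<family_cup H>> = G ->
    (forall i j, exponent (G / H i) = exponent (G / H j)) ->
  y ^+ e = 1.
Proof.
move=> e_y Ae sHG capH cupH expH.
(* Raised to the common exponent, [y] falls into every [H j], hence into their trivial
   intersection. *)
have expQ i : #[y] %| exponent (G / H i).
  rewrite order_dvdn; apply/eqP/set1P; rewrite -[[set 1]]capH inE groupX //=.
  apply/asboolP => j; rewrite (expH i j).
  have nHy : y \in 'N(H j).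
    exact: subsetP (sub_abelian_norm abelG (sHG j)) _ yG.
  apply: coset_idr; first exact: groupX.
  by rewrite morphX // expg_exponent ?mem_quotient.
apply/eqP; rewrite -order_dvdn; apply/negPn/negP => ndv.
have oy_gt0 := order_gt0 y.
have [p p_pr p_dv] : exists2 p, prime p & p %| #[y] %/ e.
  exists (pdiv (#[y] %/ e)); last exact: pdiv_dvd.
  apply: pdiv_prime; rewrite ltn_neqAle eq_sym; apply/andP; split.
    by apply: contraNneq ndv => ye1; rewrite -(divnK e_y) ye1 mul1n.
  by rewrite divn_gt0 ?(dvdn_gt0 _ e_y) // dvdn_leq.
have p_y : p %| #[y] by apply: dvdn_trans p_dv _; apply: dvdn_div.
pose q := #[y] %/ p.
(* This makes q-th powers kill [A], which leaves only powers of [y ^+ q]. *)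
have e_q : e %| q.
  rewrite /q -(divnK e_y) mulnC -muln_divA //; exact: dvdn_mulr.
have qE : #[y] = (q * p)%N by rewrite divnK.
have q_gt0 : 0 < q by move: oy_gt0; rewrite qE muln_gt0 => /andP[].
have q_lt : ~~ (#[y] %| q).
  apply/negP => /(dvdn_leq q_gt0); apply/negP.
  by rewrite qE -ltnNge ltn_Pmulr ?prime_gt1.
have powq g : g \in G -> exists j, g ^+ q = (y ^+ q) ^+ j.
  move=> /AyP[a [j [aA ->]]]; have aG := subsetP sAG _ aA; exists j.
  rewrite expgMn; last by apply: (centsP abelG); rewrite ?groupX.
  by rewrite -(divnK e_q) mulnC expgM Ae // expg1n mul1g -!expgM mulnC.
(* <[y ^+ q]> has prime order p and contains all q-th powers of G. *)
have yqH i : y ^+ q \notin H i.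
  (* Otherwise q-th powers would kill [G / H i], whose exponent is a multiple of [#[y]]. *)
  apply: contra q_lt => yqH; apply: dvdn_trans (expQ i) _.
  apply/exponentP => _ /morphimP[g nHg gG ->].
  have [j gq] := powq g gG.
  rewrite -[LHS](morphX [morphism of coset (H i)]) // gq.
  by apply: coset_id; rewrite groupX.
have expcup : exponent (family_cup H) %| q.
  apply/exponentP => h; rewrite inE => /asboolP[i hH].
  have [j hq] := powq h (subsetP (sHG i) h hH).
  have hqH : (y ^+ q) ^+ j \in H i by rewrite -hq groupX.
  (* If [p] does not divide [j], then [h ^+ q] generates [<[y ^+ q]>] and puts [y ^+ q] in [H i].
     Otherwise [h ^+ q] is a power of [y ^+ #[y]]. *)
  have [co | ] := boolP (coprime p j).
    case/negP: (yqH i); rewrite -cycle_subG; move: hqH; rewrite -cycle_subG.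
    have oyq : #[y ^+ q] = p by rewrite orderXdiv qE ?dvdn_mulr ?mulKn.
    have : generator <[y ^+ q]> ((y ^+ q) ^+ j) by rewrite generator_coprime oyq.
    by move/eqP->.
  rewrite prime_coprime // negbK => /dvdnP[r jE].
  rewrite hq jE -expgM mulnC -mulnA -[(_ * q)%N]mulnC -qE mulnC.
  by rewrite expgM expg_order expg1n.
case/negP: q_lt; rewrite order_dvdn; apply/eqP.
have abel_cup : abelian (family_cup H).
  by apply: abelianS abelG; rewrite -cupH subset_gen.
by apply: (exponentP _ _ yG); rewrite -cupH abelian_exponent_gen.
Qed.

(** The power extension is applied with [lam], the exponent of the [y]-coordinate. It is determined
    only modulo [#[y]], which is harmless since [#[y]] kills all of [G]. *)
Lemma twin_cyclic_factors_capable x :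
    x \in A -> #[x] = #[y] -> (forall a, a \in A -> a ^+ #[y] = 1) ->
  exists L : groupType, group_isomorphic (subg_of G) (central_quotient L).
Proof.
move=> xA oxy Ae.
have [lam lamP] : exists lam : gT -> nat,
    forall g, g \in G -> g * y ^- lam g \in A.
  have /choice[lam lamP] : forall g, exists j, g \in G -> g * y ^- j \in A.
    move=> g; have [/AyP[a [j [aA ->]]] | _] := boolP (g \in G).
      by exists j; rewrite mulgK.
    by exists 0.
  by exists lam.
have GE g : g \in G -> exists2 a, a \in A & g = a * y ^+ lam g.
  by move=> gG; exists (g * y ^- lam g); rewrite ?lamP // mulgVK.
have lamE a j : a \in A -> y ^+ lam (a * y ^+ j) = y ^+ j.
  move=> aA; have aG := subsetP sAG _ aA.
  have [b bA /esym gE] := GE _ (groupM aG (groupX j yG)).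
  by have [] := Ay_inj bA aA gE.
have Gy := expA_G Ae.
apply: (@power_ext_capable (subg_of G) (lam \o sgval))
  => [g h | z g h | g gE] /=.
- by apply: val_inj; apply: (centsP abelG); apply: subgP.
- rewrite -expgD; apply: (@eq_expg_dvd _ _ y).
    by apply: val_inj; rewrite val_subgX; apply/Gy/valP.
  have [a aA aE] := GE _ (valP g); have [b bA bE] := GE _ (valP h).
  rewrite -[in RHS](@lamE (a * b)) ?groupM //; congr (_ ^+ lam _).
  have abM i j : a * y ^+ i * (b * y ^+ j) = a * b * y ^+ (i + j).
    rewrite expgD -!mulgA; congr (_ * _); rewrite !mulgA; congr (_ * _).
    by apply: (centsP abelG); rewrite ?groupX // (subsetP sAG).
  by rewrite [LHS]/(val g * val h) {1}aE {1}bE; apply: abM.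
have gEv h : h \in G -> val g ^+ lam h = h ^+ lam (val g).
  by move=> hG; rewrite -(val_subgK hG) -!val_subgX; congr val; apply: gE.
(* Nondegeneracy is tested on two elements: [h = y] gives [g = y ^+ lam g], and [h = x] gives
   [x ^+ lam g = 1]. As [#[x] = #[y]], it follows that [g = 1]. *)
have xG := subsetP sAG _ xA; apply: val_inj => /=.
have lamy : y ^+ lam y = y ^+ 1.
  by have := lamE 1 1%N (group1 _); rewrite expg1 mul1g.
have lamx : y ^+ lam x = y ^+ 0.
  by have := lamE x 0%N xA; rewrite expg0 mulg1.
have gy := gEv y yG; have gx := gEv x xG; have gy1 := Gy _ (valP g).
rewrite (eq_expg_dvd gy1 lamy) expg1 in gy; rewrite gy.
rewrite (eq_expg_dvd gy1 lamx) expg0 in gx.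
by rewrite (@eq_expg_dvd _ _ x y _ 0) ?oxy ?expg_order // -gx.
Qed.

End CyclicDirectFactor.

(** * Changing the basis of a product of two cycles *)

Section ChangeOfCycles.

Variable gT : finGroupType.
Implicit Types (G H B C : {group gT}) (x y : gT).

(** A counting argument: [x'] and [y'] generate [C], and their orders divide [#[x]] and [#[y]],
    whose product is the order of [C]. So the orders agree and the two cycles meet trivially. *)
Lemma dprod_cycles_change C x y x' y' :
    abelian C -> <[x]> \x <[y]> = C -> x' \in C -> y' \in C ->
    x \in <[x']> <*> <[y']> -> y \in <[x']> <*> <[y']> ->
    x' ^+ #[x] = 1 -> y' ^+ #[y] = 1 ->
  [/\ <[x']> \x <[y']> = C, #[x'] = #[x] & #[y'] = #[y]].
Proof.
move=> abC defC x'C y'C xJ yJ /eqP; rewrite -order_dvdn => ox' /eqP.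
rewrite -order_dvdn => oy'.
have cxy : <[y']> \subset 'C(<[x']>).
  by rewrite (centSS _ _ abC) ?cycle_subG.
have defJ : <[x']> * <[y']> = C.
  rewrite -(cent_joinEr cxy); apply/eqP.
  rewrite eqEsubset join_subG !cycle_subG x'C y'C /=.
  by rewrite -(dprodWY defC) join_subG !cycle_subG xJ.
have oC := dprod_card defC; have := mul_cardG <[x']> <[y']>; rewrite defJ -oC.
rewrite -!orderE => ocap.
have cap_gt0 := cardG_gt0 (<[x']> :&: <[y']>).
have le_x := dvdn_leq (order_gt0 x) ox'; have le_y := dvdn_leq (order_gt0 y) oy'.
have xy_gt0 : 0 < #[x] * #[y] by rewrite muln_gt0 !order_gt0.
have cap1 : #|<[x']> :&: <[y']>| = 1%N.
  apply/eqP; rewrite eqn_leq cap_gt0 andbT.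
  by rewrite -(leq_pmul2l xy_gt0) muln1 -ocap leq_mul.
rewrite cap1 muln1 in ocap.
have oxx' : #[x'] = #[x].
  apply/eqP; rewrite eqn_leq le_x /= -(leq_pmul2r (order_gt0 y)) -ocap.
  by rewrite leq_mul2l le_y orbT.
have oyy' : #[y'] = #[y].
  by apply/eqP; rewrite -(eqn_pmul2l (order_gt0 x)) -ocap oxx'.
by split=> //; rewrite dprodE //; apply: card1_trivg; rewrite cap1.
Qed.

(** Both quotients are isomorphic to the complementary cycles [<[y']>] and [<[y]>], which have equal
    order. *)
Lemma dprod_cycles_change_isog G B H x y x' y' :
    abelian G -> B \x (<[x]> \x <[y]>) = G -> B \x <[x]> = H ->
    x' \in <[x]> <*> <[y]> -> y' \in <[x]> <*> <[y]> ->
    x \in <[x']> <*> <[y']> -> y \in <[x']> <*> <[y']> ->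
    x' ^+ #[x] = 1 -> y' ^+ #[y] = 1 ->
  exists H' : {group gT},
    [/\ B \x <[x']> = H', H' \subset G, H' \isog H & G / H' \isog G / H].
Proof.
move=> abG defG defH x'C y'C xJ yJ x'1 y'1.
have [[_ C _ defC] _ _ _] := dprodP defG.
have [sCG abC] : C \subset G /\ abelian C.
  have [_ /normal_sub] := dprod_normal2 defG; rewrite defC => sCG.
  by split=> //; apply: abelianS abG.
rewrite (dprodWY defC) in x'C y'C.
have [defC' ox oy] := dprod_cycles_change abC defC x'C y'C xJ yJ x'1 y'1.
have defG' : B \x (<[x']> \x <[y']>) = G by rewrite defC' -defC.
have defGH := defG; rewrite dprodA defH in defGH.
have := defG'; rewrite dprodA => /dprodP[[H' _ defH' _] _ _ _].
have defGH' := defG'; rewrite dprodA defH' in defGH'.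
have isoc u v : #[u] = #[v] -> <[u]> \isog <[v]> :> bool.
  by move=> ouv; rewrite isog_cyclic_card ?cycle_cyclic -?orderE ?ouv /=.
exists H'; split=> //.
- by have [/normal_sub] := dprod_normal2 defGH'.
- by apply: isog_dprod defH' defH _ _; rewrite ?isog_refl ?isoc.
rewrite -(isog_transl _ (sdprod_isog (dprodWsd defGH'))).
by apply: isog_trans (sdprod_isog (dprodWsd defGH)); apply: isoc.
Qed.

(** The exponents of [z] on [x] and [y] are [d] times a coprime pair [(p, q)]. Bezout completes this
    pair to a matrix of determinant 1, and [z] becomes an element of [B] times a power of the new
    [x']. Equality of the orders gives [x'] and [y'] the required order relations. *)
Lemma twin_cycles_cover G B H x y z :
    abelian G -> B \x (<[x]> \x <[y]>) = G -> B \x <[x]> = H ->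
    #[x] = #[y] -> z \in G ->
  exists H' : {group gT},
    [/\ z \in H', H' \subset G, H' \isog H & G / H' \isog G / H].
Proof.
move=> abG defG defH oxy zG.
have [[_ C _ defC] _ _ _] := dprodP defG.
have [sCG abC] : C \subset G /\ abelian C.
  have [_ /normal_sub] := dprod_normal2 defG; rewrite defC => sCG.
  by split=> //; apply: abelianS abG.
have [xC yC] : x \in C /\ y \in C.
  by rewrite -(dprodWY defC) !mem_gen // inE ?cycle_id ?orbT.
have cXX u v i j : u \in C -> v \in C -> commute (u ^+ i) (v ^+ j).
  by move=> uC vC; apply: (centsP abC); rewrite groupX.
have [b [c [bB cC zE _]]] := mem_dprod defG zG.
rewrite defC in cC.
have [_ [_ [/cycleP[i ->] /cycleP[j ->] cE _]]] := mem_dprod defC cC.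
(* Adding #[x] to the exponent of x makes it positive, as Bezout needs. *)
pose i' := (i + #[x])%N.
have xi' : x ^+ i' = x ^+ i by rewrite expgD expg_order mulg1.
have i'_gt0 : 0 < i' by rewrite addn_gt0 order_gt0 orbT.
pose d := gcdn i' j; have d_gt0 : 0 < d by rewrite gcdn_gt0 i'_gt0.
pose p := i' %/ d; pose q := j %/ d.
have [pd qd] : (p * d)%N = i' /\ (q * d)%N = j.
  by rewrite !divnK ?dvdn_gcdl ?dvdn_gcdr.
have [u [v uvE]] : exists u v, (u * p)%N = (v * q).+1.
  have [u v uv _] := egcdnP j i'_gt0; exists u, v.
  by apply/eqP; rewrite -(eqn_pmul2r d_gt0) -mulnA pd uv mulSn -mulnA qd addnC.
(* A change of basis of determinant u * p - v * q = 1. *)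
pose x' := x ^+ p * y ^+ q; pose y' := x ^+ v * y ^+ u.
have x'X r : x' ^+ r = x ^+ (p * r) * y ^+ (q * r).
  by rewrite expgMn ?expgM //; apply: cXX.
have y'X r : y' ^+ r = x ^+ (v * r) * y ^+ (u * r).
  by rewrite expgMn ?expgM //; apply: cXX.
have x'J : x' \in <[x']> <*> <[y']> by rewrite mem_gen // inE cycle_id.
have y'J : y' \in <[x']> <*> <[y']> by rewrite mem_gen // inE cycle_id orbT.
(* The inverse matrix recovers the old cycles from the new ones. *)
have xE : x = x' ^+ u * y' ^- q.
  apply: (mulIg (y' ^+ q)); rewrite mulgVK x'X y'X (mulnC p) uvE expgS.
  by rewrite (mulnC q) !mulgA.
have yE : y = x' ^- v * y' ^+ p.
  apply: (mulgI (x' ^+ v)); rewrite mulVKg x'X y'X (mulnC p) -mulgA.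
  by rewrite uvE expgSr (mulnC q).
have [||||||H' [defH' sH'G isoH isoQ]] :=
  @dprod_cycles_change_isog G B H x y x' y' abG defG defH.
- by rewrite (dprodWY defC) groupM ?groupX.
- by rewrite (dprodWY defC) groupM ?groupX.
- by rewrite [X in X \in _]xE groupM ?groupV ?groupX.
- by rewrite [X in X \in _]yE groupM ?groupV ?groupX.
- by rewrite x'X {2}oxy !(mulnC _ #[_]) !expgM !expg_order !expg1n mulg1.
- by rewrite y'X -{1}oxy !(mulnC _ #[_]) !expgM !expg_order !expg1n mulg1.
exists H'; split=> //; rewrite zE cE -xi' -pd -qd -x'X -(dprodW defH').
by rewrite mem_mulg ?mem_cycle.
Qed.

(** The shear replaces [x] by [x * y ^+ d], where [d = #[y] / #[x]] is chosen so that [#[x]] still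
    kills the result. An element common to [B \x <[x]>] and the sheared group has trivial
    [y]-coordinate, which forces it into [B]. *)
Lemma shear_cycles_avoid G B H x y z :
    abelian G -> B \x (<[x]> \x <[y]>) = G -> B \x <[x]> = H ->
    #[x] %| #[y] -> z \in H -> z \notin B ->
  exists H' : {group gT},
    [/\ z \notin H', H' \subset G, H' \isog H & G / H' \isog G / H].
Proof.
move=> abG defG defH oxy zH znB.
have [[_ C _ defC] _ _ _] := dprodP defG.
have [_ /normal_sub] := dprod_normal2 defG; rewrite defC => sCG.
have [xC yC] : x \in C /\ y \in C.
  by rewrite -(dprodWY defC) !mem_gen // inE ?cycle_id ?orbT.
have cxy i j : commute (x ^+ i) (y ^+ j).
  by apply: (centsP abG); rewrite groupX // (subsetP sCG).
pose d := #[y] %/ #[x]; pose x' := x * y ^+ d.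
have x'X r : x' ^+ r = x ^+ r * y ^+ (d * r).
  by rewrite expgMn ?expgM //; apply: (cxy 1%N).
have yJ u : y \in <[u]> <*> <[y]> by rewrite mem_gen // inE cycle_id orbT.
have x'J : x' \in <[x']> <*> <[y]> by rewrite mem_gen // inE cycle_id.
have xJ : x \in <[x]> <*> <[y]> by rewrite mem_gen // inE cycle_id.
have [||||||H' [defH' sH'G isoH isoQ]] :=
  dprod_cycles_change_isog (x' := x') (y' := y) abG defG defH.
- by rewrite groupM ?groupX ?yJ.
- exact: yJ.
- by rewrite -(mulgK (y ^+ d) x) groupM ?groupV ?groupX ?yJ.
- exact: yJ.
- by rewrite x'X expg_order mul1g divnK // expg_order.
- by rewrite expg_order.
exists H'; split=> //; apply: contra znB => zH'.
have [b [_ [bB /cycleP[s ->] zE _]]] := mem_dprod defH zH.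
have [b' [_ [b'B /cycleP[r ->] zE' _]]] := mem_dprod defH' zH'.
have [c [e [cB eC _ uniqG]]] := mem_dprod defG (subsetP sH'G _ zH').
have inC t : t \in C -> t \in <[x]> \x <[y]> by rewrite defC.
have [bc xse] : b = c /\ x ^+ s = e.
  by apply: uniqG => //; apply: inC; apply: groupX.
have [b'c x're] : b' = c /\ x' ^+ r = e.
  by apply: uniqG => //; apply: inC; rewrite !(groupX, groupM).
have eC' : e \in C by rewrite -defC.
have [p [q [_ _ _ uniqC]]] := mem_dprod defC eC'.
have [xp q1] : x ^+ s = p /\ 1 = q.
  by apply: uniqC; rewrite ?mem_cycle ?group1 ?mulg1.
have [xp' yq] : x ^+ r = p /\ y ^+ (d * r) = q.
  by apply: uniqC; rewrite ?mem_cycle // -x'X.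
have xr1 : x ^+ r = 1.
  apply/eqP; rewrite -order_dvdn.
  have d_gt0 : 0 < d.
    have /(dvdn_leq (order_gt0 y)) le_xy := oxy.
    by rewrite divn_gt0 // order_gt0.
  (* Here [#[y] = d * #[x]] divides [d * r], and [d] cancels. *)
  rewrite -(dvdn_pmul2l d_gt0) [X in X %| _](divnK oxy) order_dvdn.
  by rewrite yq -q1.
by rewrite zE xp -xp' xr1 mulg1.
Qed.

End ChangeOfCycles.

(** * The family of subgroups for (d) *)

(** The index type consists of all subgroups satisfying [P]. Changes of basis in the cycles of [l']
    and [l] cover [G]. Shears of each other cycle along that of [l] make the intersection
    trivial. *)
Lemma twin_basis_family (gT : finGroupType) (G : {group gT}) k
    (g : 'I_k -> gT) (l l' : 'I_k) :
    abelian G -> \big[dprod/1]_i <[g i]> = G ->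
    l' != l -> #[g l'] = #[g l] -> (forall i, #[g i] %| #[g l]) ->
  exists (I : Type) (H : I -> {group gT}),
    [/\ forall i, H i \subset G,
        family_cap G H = 1,
        family_cup H = G,
        forall i j, G / H i \isog G / H j
      & forall i j, H i \isog H j].
Proof.
move=> abG defG nl'l eq_o dv_o.
have defGl := defG; rewrite (bigD1 l) //= in defGl.
have [[_ K _ defK] _ _ _] := dprodP defGl.
have defGK : K \x <[g l]> = G by rewrite dprodC -defK.
have factor i : i != l -> exists B : {group gT},
    [/\ \big[dprod/1]_(j | (j != l) && (j != i)) <[g j]> = B,
        B \x <[g i]> = K & B \x (<[g i]> \x <[g l]>) = G].
  move=> il; have defKi := defK; rewrite (bigD1 i) //= in defKi.
  have [[_ B _ defB] _ _ _] := dprodP defKi.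
  have defBK : B \x <[g i]> = K by rewrite dprodC -defB.
  by exists B; rewrite dprodA defBK.
pose P (H : {group gT}) := [/\ H \subset G, H \isog K & G / H \isog G / K].
exists {H | P H}, sval.
split=> [[H []] | | | [? [_ _ Q1]] [? [_ _ Q2]] | [? [_ Q1 _]] [? [_ Q2 _]]] //=.
- apply/eqP; rewrite eqEsubset sub1set inE group1 /= andbC; apply/andP; split.
    by apply/asboolP => i; apply: group1.
  apply/subsetP => z; rewrite !inE => /andP[zG /asboolP zH].
  have [/normal_sub sKG _] := dprod_normal2 defGK.
  have PK : P K by split; rewrite ?isog_refl.
  have zK : z \in K := zH (exist _ K PK).
  have zB i (B : {group gT}) : i != l ->
      \big[dprod/1]_(j | (j != l) && (j != i)) <[g j]> = B -> z \in B.
    move=> il defB; have [B' [defB' defBK defBG]] := factor i il.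
    have -> : B :=: B' by rewrite -defB -defB'.
    apply/negPn/negP => znB.
    have [H' [znH' sH' isoH' isoQ']] :=
      shear_cycles_avoid abG defBG defBK (dv_o i) zK znB.
    by case/negP: znH'; apply: (zH (exist _ H' (And3 sH' isoH' isoQ'))).
  have [c [_ zE uniq_c]] := mem_bigdprod defK zK.
  rewrite zE; apply/eqP; apply: big1 => i il.
  have [B [defB _ _]] := factor i il.
  have [e [eB zE' _]] := mem_bigdprod defB (zB i B il defB).
  (* Since [z] lies in the product without the factor [i], it has coordinates with 1 at [i]; by
     uniqueness [c i = 1]. *)
  pose e' j := if j == i then 1 else e j.
  rewrite -(uniq_c e') ?/e' ?eqxx // => [j jl|].
    by case: eqP => [_ | /eqP ji]; rewrite ?group1 // eB // jl.
  rewrite zE' big_mkcond [RHS]big_mkcond; apply: eq_bigr => j _ /=.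
  by case: (j != l) => //=; case: eqP.
- apply/eqP; rewrite eqEsubset; apply/andP; split; apply/subsetP => z.
    by rewrite inE => /asboolP[[H [sHG _ _]]] /= /(subsetP sHG).
  move=> zG; rewrite inE; apply/asboolP.
  have [B [_ defBK defBG]] := factor l' nl'l.
  have [H [zH sH isoH isoQ]] := twin_cycles_cover abG defBG defBK eq_o zG.
  by exists (exist _ H (And3 sH isoH isoQ)).
- by apply: isog_trans Q1 _; rewrite isog_sym.
- by apply: isog_trans Q1 _; rewrite isog_sym.
Qed.

(** * The complement of the last basis element *)

Lemma tuple_dvdn k (n : k.-tuple nat) i j :
    (forall i j : 'I_k, j = i.+1 :> nat -> tnth n i %| tnth n j) ->
    i <= j -> j < k ->
  nth 0 n i %| nth 0 n j.
Proof.
move=> n_dvd; elim: j => [|j IHj]; first by rewrite leqn0 => /eqP->.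
rewrite leq_eqVlt => /predU1P[-> // | ij] jk.
apply: dvdn_trans (IHj ij (ltnW jk)) _.
have := n_dvd (Ordinal (ltnW jk)) (Ordinal jk) erefl.
by rewrite !(tnth_nth 0).
Qed.

Lemma cyclic_product_cofactor (gT : finGroupType) (G : {group gT}) (k : nat)
    (n : k.-tuple nat) (g : 'I_k -> gT) (l : 'I_k) :
    abelian G -> \big[dprod/1]_i <[g i]> = G ->
    (forall i, #[g i] = tnth n i) ->
    (forall i j : 'I_k, j = i.+1 :> nat -> tnth n i %| tnth n j) ->
    l = k.-1 :> nat ->
  exists (A : {group gT}) e,
    [/\ A \x <[g l]> = G /\ forall i, i != l -> g i \in A,
        e %| #[g l], forall a, a \in A -> a ^+ e = 1,
        g l ^+ e = 1 -> #[g l] != 1%N ->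
          1 < k /\ nth 0 n (k - 2) = nth 0 n (k - 1)
      & 1 < k -> e = nth 0 n (k - 2)].
Proof.
move=> abG defG og n_dvd lk.
have k_gt0 : 0 < k := leq_ltn_trans (leq0n l) (ltn_ord l).
have ol : #[g l] = nth 0 n (k - 1) by rewrite og (tnth_nth 0) lk subn1.
have defGl := defG; rewrite (bigD1 l) //= in defGl.
have [[_ A _ defA] _ _ _] := dprodP defGl.
have defGA : A \x <[g l]> = G by rewrite dprodC -defA.
(* For [k = 1] the truncated index [k - 2] would select the order of [g l] itself, whereas [A] is
   trivial and the right exponent is 1. *)
pose e := if 1 < k then nth 0 n (k - 2) else 1%N.
have e_dv : e %| #[g l].
  rewrite /e ol; case: ifP => // k_gt1; apply: tuple_dvdn => //.
    by rewrite leq_sub2l.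
  by rewrite ltn_subrL.
exists A, e; split=> //; last by rewrite /e => ->.
  split=> // i il; rewrite -(bigdprodWY defA) mem_gen //.
  by apply/bigcupP; exists i; rewrite ?cycle_id.
  have [/normal_sub sAG _] := dprod_normal2 defGA.
  have defA' := bigdprodWY defA.
  move=> a aA; apply: exponentP aA; rewrite -defA'.
  rewrite abelian_exponent_gen; last first.
    by rewrite -abelian_gen defA' (abelianS sAG).
  apply/exponentP => x /bigcupP[i il /cycleP[m ->]].
  have i_lt : i < k.-1.
    by rewrite ltn_neqAle -lk -[_ == _ :> nat]/(i == l) il /= lk -ltnS prednK.
  have k_gt1 : 1 < k by rewrite -ltn_predRL (leq_ltn_trans (leq0n i)).
  have : #[g i] %| e.
    rewrite og (tnth_nth 0) /e k_gt1; apply: tuple_dvdn => //.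
      by rewrite -ltnS -subSn // subSS subn1.
    by rewrite ltn_subrL.
  by rewrite order_dvdn -expgM mulnC expgM => /eqP->; rewrite expg1n.
(* For [k = 1] the order of [g l] would be 1. Otherwise the last two entries divide each other. *)
move=> /eqP; rewrite -order_dvdn /e; case: ifP => [k_gt1 ol_e _ | _]; last first.
  by rewrite dvdn1 => /eqP->.
split=> //; apply/eqP; rewrite eqn_dvd -{2}ol ol_e andbT.
by move: e_dv; rewrite /e k_gt1 ol.
Qed.

(** * Equivalence of the four conditions *)

Theorem theorem1 (gT : finGroupType) (G : {group gT}) (k : nat)
    (n : k.-tuple nat)
    (abelG : abelian G) (ntG : G :!=: 1)
    (n_gt1 : forall i : 'I_k, (1 < tnth n i)%N)
    (n_dvd : forall i j : 'I_k, j = i.+1 :> nat -> (tnth n i %| tnth n j)%N)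
    (isoG : G \isog [set: cyclic_product n]) :
  [<-> (* (a) *)
       exists L : groupType, group_isomorphic (subg_of G) (central_quotient L);
       (* (b) *)
       (2 <= k)%N /\ nth 0 n (k - 2) = nth 0 n (k - 1);
       (* (c) *)
       exists (I : Type) (H : I -> {group gT}),
         [/\ forall i, H i \subset G,
             family_cap G H = 1,
             <<family_cup H>> = G
           & forall i j, exponent (G / H i) = exponent (G / H j)];
       (* (d) *)
       exists (I : Type) (H : I -> {group gT}),
         [/\ forall i, H i \subset G,
             family_cap G H = 1,
             family_cup H = G,
             forall i j, G / H i \isog G / H j
           & forall i j, H i \isog H j]].
Proof.
have [g [defG og]] := cyclic_product_basis n_gt1 isoG.
have k_gt0 : (0 < k)%N.
  rewrite lt0n; apply: contra ntG => /eqP k0; rewrite -defG big1 // => i.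
  by have := ltn_ord i; rewrite [X in (_ < X)%N]k0.
have l_lt : (k.-1 < k)%N by rewrite prednK.
pose l := Ordinal l_lt.
have [A [e [[defGA gA] e_dv Ae bI eE]]] :=
  cyclic_product_cofactor (l := l) abelG defG og n_dvd erefl.
have ol_neq1 : #[g l] != 1%N by rewrite og neq_ltn n_gt1 orbT.
have capable_twin (L : groupType) :
    group_isomorphic (subg_of G) (central_quotient L) ->
    (2 <= k)%N /\ nth 0 n (k - 2) = nth 0 n (k - 1).
  by move=> /(capable_cyclic_factor abelG defGA Ae)/bI; apply.
have twin (b : (2 <= k)%N /\ nth 0 n (k - 2) = nth 0 n (k - 1)) :
    exists l' : 'I_k, [/\ l' != l, #[g l'] = #[g l] & e = #[g l]].
  have [k_gt1 eq_n] := b; have l'_lt : (k - 2 < k)%N by rewrite ltn_subrL.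
  exists (Ordinal l'_lt); rewrite !og !(tnth_nth 0) /= (eE k_gt1) -!subn1.
  split; rewrite // -val_eqE /= -subn1.
  by rewrite neq_ltn ltn_sub2l.
have family_b (I : Type) (H : I -> {group gT}) :
    (forall i, H i \subset G) -> family_cap G H = 1 -> <<family_cup H>> = G ->
    (forall i j, exponent (G / H i) = exponent (G / H j)) ->
    (2 <= k)%N /\ nth 0 n (k - 2) = nth 0 n (k - 1).
  move=> sHG capH cupH expH; apply: bI ol_neq1.
  exact: (family_cyclic_factor abelG defGA e_dv Ae sHG).
have dv_ol i : (#[g i] %| #[g l])%N.
  rewrite !og !(tnth_nth 0); apply: tuple_dvdn => //=.
  by rewrite -ltnS prednK.
have b_family b := let: ex_intro l' (And3 nl'l o_eq _) := twin b in
  twin_basis_family abelG defG nl'l o_eq dv_ol.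
(* Each implication passes through (b). The family built for (d) also serves for (c), because
   isomorphic quotients have equal exponents. *)
tfae.
- by case=> L /capable_twin.
- move=> /b_family[I [H [sHG capH cupH isoQ _]]]; exists I, H; split=> //.
    by rewrite cupH genGid.
  by move=> i j; apply: exponent_isog.
- by case=> I [H [sHG capH cupH expH]]; apply/b_family/family_b/expH.
case=> I [H [sHG capH cupH isoQ _]].
have /twin[l' [nl'l o_eq eol]] : (2 <= k)%N /\ nth 0 n (k - 2) = nth 0 n (k - 1).
  apply: (family_b I H) => //; first by rewrite cupH genGid.
  by move=> i j; apply: exponent_isog.
apply: (twin_cyclic_factors_capable abelG defGA (x := g l')) => //.
  exact: gA.
by rewrite -eol.
Qed.
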